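(* Let $F$ be a field of characteristic $2$. The map from the set of sums of two symbols in $K_2(F)/2K_2(F)$ to $K_4(F)/2K_4(F)$ given by $$\{a,b\}_2+\{c,d\}_2\longmapsto \{a,b,c,d\}_2\qquad (a,b,c,d\in F^\times)$$ is well-defined. That is, if $a,b,c,d,\alpha,\beta,\gamma,\delta\in F^\times$ satisfy $\{a,b\}_2+\{c,d\}_2=\{\alpha,\beta\}_2+\{\gamma,\delta\}_2$ in $K_2(F)/2K_2(F)$, then $\{a,b,c,d\}_2=\{\alpha,\beta,\gamma,\delta\}_2$ in $K_4(F)/2K_4(F)$.
   Context: $K_n(F)$ is the $n$-th Milnor $K$-group of $F$, and $\{\alpha_1,\dots,\alpha_n\}_2$ denotes the class of the symbol $\{\alpha_1,\dots,\alpha_n\}$ ($\alpha_i\in F^\times$) in $K_n(F)/2K_n(F)$. *)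

(* Defs.v *)
From HB Require Import structures.
From mathcomp Require Import all_boot all_order all_algebra.
From mathcomp Require Import boolp.
From mathcomp Require Import freeg.

Set Implicit Arguments.
Unset Strict Implicit.
Unset Printing Implicit Defensive.

Import GRing.Theory Quotient.

Local Open Scope ring_scope.
Local Open Scope quotient_scope.

Definition units (F : fieldType) := {x : F | x != 0}.

Section Subgroups.
Variable V : zmodType.

Inductive generated (P : V -> Prop) : V -> Prop :=
| generated_incl x : P x -> generated P x
| generated_zero : generated P 0
| generated_sub x y : generated P x -> generated P y -> generated P (x - y).

Definition subgroup_generated (P : V -> Prop) : {pred V} :=
  fun x => `[< generated P x >].

Fact subgroup_generated_closed P : zmod_closed (subgroup_generated P).
Proof.
split=> [|x y]; rewrite ?unfold_in; first by apply/asboolP/generated_zero.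
by move=> /asboolP Px /asboolP Py; apply/asboolP/generated_sub.
Qed.

HB.instance Definition _ (P : V -> Prop) :=
  GRing.isZmodClosed.Build V (subgroup_generated P)
    (subgroup_generated_closed P).

Definition multiples (m : nat) : {pred V} :=
  fun x => `[< exists y : V, x = y *+ m >].

Fact multiples_closed m : zmod_closed (multiples m).
Proof.
split=> [|x y]; rewrite ?unfold_in.
  by apply/asboolP; exists 0; rewrite mul0rn.
by move=> /asboolP[u ->] /asboolP[v ->]; apply/asboolP; exists (u - v);
  rewrite mulrnBl.
Qed.

HB.instance Definition _ (m : nat) :=
  GRing.isZmodClosed.Build V (multiples m) (multiples_closed m).

End Subgroups.

Section MilnorK.
Variable F : fieldType.

(* The degree n part of the tensor algebra of the Z-module of units, modulo the
   two-sided ideal generated by the tensors of a and 1 - a, is presented by the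
   n-tuples of units, subject to multilinearity in each slot and to the
   vanishing of the tuples with two consecutive entries of sum 1. *)
Inductive milnor_relation (n : nat) : {freeg (n.-tuple (units F))} -> Prop :=
| milnor_multilinear (s1 s2 : seq (units F)) (a b c : units F)
    (ta tb tc : n.-tuple (units F)) :
    val c = val a * val b ->
    ta = s1 ++ a :: s2 :> seq _ ->
    tb = s1 ++ b :: s2 :> seq _ ->
    tc = s1 ++ c :: s2 :> seq _ ->
    milnor_relation (<< tc >> - (<< ta >> + << tb >>))
| milnor_steinberg (s1 s2 : seq (units F)) (a b : units F)
    (t : n.-tuple (units F)) :
    val a + val b = 1 ->
    t = s1 ++ a :: b :: s2 :> seq _ ->
    milnor_relation << t >>.

Definition milnorK (n : nat) : zmodType :=
  {quot (subgroup_generated (@milnor_relation n))}.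

Definition symbol (n : nat) (t : n.-tuple (units F)) : milnorK n :=
  \pi_{quot (subgroup_generated (@milnor_relation n))} << t >>.

Definition milnorK_mod (m n : nat) : zmodType :=
  {quot (@multiples (milnorK n) m)}.

Definition symbol_mod (m n : nat) (t : n.-tuple (units F)) : milnorK_mod m n :=
  \pi_{quot (@multiples (milnorK n) m)} (symbol t).

End MilnorK.

(* Main.v *)
(** Over a field of characteristic 2 one has [{x, x} = 0], so concatenation of
    symbols induces on [k_n = K_n / 2] a symmetric biadditive form [B], with
    values in [k_2n], that vanishes on pairs of symbols sharing an entry.  The
    second divided power [gamma] sends a sum of symbols [s_1 + ... + s_r] to
    the sum over [i < j] of the [B s_i s_j].  It is defined on the free abelian
    group on the tuples and satisfies
    [gamma (x + y) = gamma x + gamma y + B x y].  For [n >= 2], two distinct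
    tuples occurring in one multilinearity relation share an entry, so [gamma]
    kills every relation, hence descends to [k_n], and it maps
    [{a, b} + {c, d}] to [{a, b, c, d}]. *)
Require Import Defs.
From mathcomp Require Import all_boot all_order all_algebra.
From mathcomp Require Import boolp wochoice freeg.

Set Implicit Arguments.
Unset Strict Implicit.
Unset Printing Implicit Defensive.

Import GRing.Theory Quotient.

Local Open Scope ring_scope.
Local Open Scope quotient_scope.

(** * Induction and biadditive extension on free abelian groups *)

Lemma freeg_zmod_ind (T : choiceType) (P : {freeg T} -> Prop) :
  P 0 -> (forall t, P << t >>) -> (forall x y, P x -> P y -> P (x - y)) ->
  forall x, P x.
Proof.
move=> P0 PU PB.
have PN x : P x -> P (- x) by move=> Px; rewrite -sub0r; apply: (PB).
have PD x y : P x -> P y -> P (x + y).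
  by move=> Px Py; rewrite -[y]opprK; apply: (PB) => //; apply: PN.
have Pn n t : P (<< t >> *+ n).
  by elim: n => [|n IHn]; rewrite ?mulr0n // mulrS; apply: PD.
have Pz (k : int) t : P << k *g t >>.
  have -> : << k *g t >> = << t >> *~ k :> {freeg T}.
    by rewrite freegU_mulz intz.
  by case: k => n; [rewrite -pmulrn | rewrite NegzE mulrNz -pmulrn; apply: PN].
by move=> x; rewrite -[x]freeg_sumE; elim/big_ind: _ => [//|//|t _]; apply: Pz.
Qed.

Section Bilinear.
Variables (T : choiceType) (V : zmodType).
Implicit Types (f : T -> T -> V) (x y z : {freeg T}).

(* [zmodule V] is [V] as a module over the integers, as [fglift] requires. *)
Definition bilift f x y : V :=
  fglift (fun s => fglift (f s : T -> zmodule V) y : zmodule V) x.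

Lemma fgliftB (h : T -> zmodule V) x y :
  fglift h (x - y) = fglift h x - fglift h y.
Proof. exact: lift_is_additive. Qed.

Lemma fglift0 (h : T -> zmodule V) : fglift h 0 = 0.
Proof. by have := fgliftB h 0 0; rewrite !subrr. Qed.

Lemma biliftU f s t : bilift f << s >> << t >> = f s t.
Proof. by rewrite /bilift !liftU !scale1r. Qed.

Lemma biliftBl f x y z : bilift f (x - y) z = bilift f x z - bilift f y z.
Proof. exact: fgliftB. Qed.

Lemma bilift0l f z : bilift f 0 z = 0.
Proof. by have := biliftBl f 0 0 z; rewrite !subrr. Qed.

Lemma biliftNl f x z : bilift f (- x) z = - bilift f x z.
Proof. by have := biliftBl f 0 x z; rewrite bilift0l !sub0r. Qed.

Lemma biliftDl f x y z : bilift f (x + y) z = bilift f x z + bilift f y z.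
Proof. by rewrite -{1}[y]opprK biliftBl biliftNl opprK. Qed.

(** Both sides are biadditive and agree on generators. This transfers additivity from the first
    argument of [bilift] to the second. *)
Lemma bilift_swap f x y : bilift f x y = bilift (fun s t => f t s) y x.
Proof.
have swapl s z : bilift (fun u t => f t u) z << s >> = bilift f << s >> z.
  rewrite /bilift liftU scale1r.
  elim/freeg_zmod_ind: z => [|t|z1 z2 IH1 IH2].
  - by rewrite !fglift0.
  - by rewrite !liftU !scale1r.
  - by rewrite !fgliftB IH1 IH2.
elim/freeg_zmod_ind: x => [|s|x1 x2 IH1 IH2].
- rewrite bilift0l; elim/freeg_zmod_ind: y => [|t|y1 y2 IH1 IH2].
  + by rewrite bilift0l.
  + by rewrite /bilift liftU scale1r fglift0.
  + by rewrite biliftBl -IH1 -IH2 subrr.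
- by rewrite swapl.
- rewrite biliftBl IH1 IH2.
  elim/freeg_zmod_ind: y {IH1 IH2} => [|t|y1 y2 IH1 IH2].
  + by rewrite !bilift0l subrr.
  + by rewrite /bilift !liftU !scale1r fgliftB.
  + by rewrite !biliftBl -IH1 -IH2 !opprD addrACA.
Qed.

Lemma biliftBr f x y z : bilift f x (y - z) = bilift f x y - bilift f x z.
Proof. by rewrite !(bilift_swap f x) biliftBl. Qed.

Lemma biliftDr f x y z : bilift f x (y + z) = bilift f x y + bilift f x z.
Proof. by rewrite !(bilift_swap f x) biliftDl. Qed.

Lemma bilift0r f x : bilift f x 0 = 0.
Proof. by rewrite bilift_swap bilift0l. Qed.

Lemma eq_bilift f g : (forall s t, f s t = g s t) ->
  forall x y, bilift f x y = bilift g x y.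
Proof.
move=> eq_fg x y; elim/freeg_zmod_ind: x => [|s|x1 x2 IH1 IH2].
- by rewrite !bilift0l.
- elim/freeg_zmod_ind: y => [|t|y1 y2 IH1 IH2].
  + by rewrite !bilift0r.
  + by rewrite !biliftU.
  + by rewrite !biliftBr IH1 IH2.
- by rewrite !biliftBl IH1 IH2.
Qed.

End Bilinear.

(** * Quadratic maps with a given alternating polar form *)

Section DividedSquare.
Variables (T : choiceType) (V : zmodType) (f : T -> T -> V).
Hypothesis V2 : forall v : V, v + v = 0.
Hypothesis f_sym : forall s t, f s t = f t s.
Hypothesis f_alt : forall s, f s s = 0.

Lemma bilift_sym x y : bilift f x y = bilift f y x.
Proof. by rewrite bilift_swap; apply: eq_bilift. Qed.

Lemma bilift_alt x : bilift f x x = 0.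
Proof.
elim/freeg_zmod_ind: x => [|s|x y IHx IHy].
- exact: bilift0l.
- by rewrite biliftU.
- rewrite biliftBl !biliftBr IHx IHy (bilift_sym y x).
  by rewrite sub0r subr0 -opprD V2 oppr0.
Qed.

(* For a total order on [T], the form [bilift f] is the symmetrization of
   [bilift g], where [g] is [f] on increasing pairs and 0 elsewhere; take
   [gamma x] to be [bilift g x x]. *)
Lemma divided_square_exists : exists gamma : {freeg T} -> V,
  (forall t, gamma << t >> = 0) /\
  (forall x y, gamma (x + y) = gamma x + gamma y + bilift f x y).
Proof.
have [R /withinW Rwo] := well_ordering_principle T.
have Rwo' : wo_chain R predT by move=> A _; apply: Rwo (fun _ => id).
have Rtot : total R by move=> s t; apply: (wo_chainW Rwo').
have Ranti s t : R s t -> R t s -> s = t.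
  by move=> st ts; apply: (wo_chain_antisymmetric Rwo'); rewrite ?st.
pose g s t := if R s t then f s t else 0.
have gB x y : bilift g x y + bilift g y x = bilift f x y.
  elim/freeg_zmod_ind: x => [|s|x1 x2 IH1 IH2].
  - by rewrite !bilift0l bilift0r addr0.
  - elim/freeg_zmod_ind: y => [|t|y1 y2 IH1 IH2].
    + by rewrite !bilift0r bilift0l addr0.
    + rewrite !biliftU /g (f_sym t s).
      (* Both orders hold only if [s = t], where [f_alt] applies; totality rules out that neither
         holds. *)
      case: ifP => [st|]; case: ifP => [ts|]; rewrite ?addr0 ?add0r //.
        by rewrite (Ranti _ _ st ts) f_alt addr0.
      by have := Rtot s t => /orP[] ->.
    + by rewrite !(biliftBl, biliftBr) -IH1 -IH2 addrACA opprD.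
  - by rewrite !(biliftBl, biliftBr) -IH1 -IH2 addrACA opprD.
exists (fun x => bilift g x x); split=> [t|x y].
  by rewrite biliftU /g f_alt if_same.
rewrite biliftDl !biliftDr -gB !addrA -!addrA; congr (_ + _).
by rewrite [RHS]addrC !addrA.
Qed.

End DividedSquare.

(** * Symbols modulo [m] *)

Section Symbols.
Variables (F : fieldType) (m n : nat).
Implicit Types (a b c : units F) (s t u : seq (units F)).

Definition units_mul a b : units F :=
  exist _ (val a * val b) (mulf_neq0 (valP a) (valP b)).

Definition units_inv a : units F := exist _ (val a)^-1 (invr_neq0 (valP a)).

(* Indexing symbols by plain sequences, with value 0 on those of size other
   than [n], avoids transporting tuples along equalities of sizes. *)
Definition seq_symbol s : milnorK_mod F m n :=
  oapp (@symbol_mod F m n) 0 (insub s).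

Lemma seq_symbolE (t : n.-tuple (units F)) : seq_symbol t = symbol_mod m t.
Proof. by rewrite /seq_symbol valK. Qed.

Lemma relation_pi_eq0 (x : {freeg (n.-tuple (units F))}) : milnor_relation x ->
  \pi_(milnorK F n) x = 0.
Proof.
move=> Rx; rewrite -[RHS](raddf0 \pi_(milnorK F n)).
apply/eqP; rewrite -idealrBE subr0; exact/asboolP/generated_incl.
Qed.

Lemma seq_symbolM s1 s2 a b c : val c = val a * val b ->
  seq_symbol (s1 ++ c :: s2) =
  seq_symbol (s1 ++ a :: s2) + seq_symbol (s1 ++ b :: s2).
Proof.
move=> cE; have [|/eqP sz] := eqVneq (size (s1 ++ c :: s2)) n; last first.
  (* For a wrong size all three symbols take the default value 0. *)
  by rewrite /seq_symbol !insubF ?addr0 //;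
    apply/negbTE; move/eqP: sz; rewrite !size_cat.
move=> /eqP szc.
have sza : size (s1 ++ a :: s2) == n by rewrite -(eqP szc) !size_cat.
have szb : size (s1 ++ b :: s2) == n by rewrite -(eqP szc) !size_cat.
rewrite -[s1 ++ c :: s2]/(tval (Tuple szc)) -[s1 ++ a :: s2]/(tval (Tuple sza)).
rewrite -[s1 ++ b :: s2]/(tval (Tuple szb)) !seq_symbolE /symbol_mod -raddfD.
congr (\pi _); apply/eqP; rewrite -subr_eq0 /symbol -!raddfD -raddfB.
by apply/eqP/relation_pi_eq0; apply: (@milnor_multilinear F n s1 s2 a b c).
Qed.

Lemma seq_symbol_steinberg s1 s2 a b : val a + val b = 1 ->
  seq_symbol (s1 ++ a :: b :: s2) = 0.
Proof.
move=> ab1; rewrite /seq_symbol; case: insubP => //= t _ tE.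
rewrite /symbol_mod /symbol relation_pi_eq0 ?raddf0 //.
exact: milnor_steinberg ab1 tE.
Qed.

(** Since [1 = 1 * 1], the symbol equals its own double. *)
Lemma seq_symbol1 s1 s2 a : val a = 1 -> seq_symbol (s1 ++ a :: s2) = 0.
Proof.
move=> a1; have aE : val a = val a * val a by rewrite a1 mulr1.
apply: (addrI (seq_symbol (s1 ++ a :: s2))).
by rewrite -(seq_symbolM _ _ aE) addr0.
Qed.

End Symbols.

(** * Symbols modulo 2 in characteristic 2 *)

Section CharTwo.
Variables (F : fieldType) (n : nat).
Hypothesis charF2 : 2%N \in [pchar F].
Implicit Types (a b c : units F) (s t u : seq (units F)).
Local Notation "$ s" := (seq_symbol 2 n s) (at level 10).

Lemma milnorK_mod2_addxx (x : milnorK_mod F 2 n) : x + x = 0.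
Proof.
rewrite -[x]reprK -raddfD -[RHS](raddf0 \pi_(milnorK_mod F 2 n)).
apply/eqP; rewrite -idealrBE subr0; apply/asboolP.
by exists (repr x); rewrite mulr2n.
Qed.

(* Write [1 + a = a c] with [c = 1 + a^-1]: both [{a, 1 + a}] and
   [{a, c} = - {a^-1, c}] are Steinberg symbols. *)
Lemma seq_symbol_xx s1 s2 a : $ (s1 ++ a :: a :: s2) = 0.
Proof.
(* For [a = 1] the element [1 + a] is 0, hence not a unit. *)
have [a1|a_neq1] := eqVneq (val a) 1; first by rewrite seq_symbol1.
have addKx (x y : F) : x + (y + x) = y.
  by rewrite addrC -addrA addrr_pchar2 ?addr0.
have c_neq0 : 1 + (val a)^-1 != 0.
  apply: contra a_neq1 => /eqP c0; rewrite -[val a]invrK.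
  by have := addKx (val a)^-1 1; rewrite c0 addr0 => ->; rewrite invr1.
pose c : units F := exist (fun x : F => x != 0) _ c_neq0.
pose b := units_mul a c.
have bE : val b = val a * val c by [].
have bS : val b = 1 + val a.
  by rewrite bE /= mulrDr mulr1 mulfV ?(valP a) // addrC.
have ab0 : $ (s1 ++ a :: b :: s2) = 0.
  by rewrite seq_symbol_steinberg // bS addKx.
have dc0 : $ (s1 ++ units_inv a :: c :: s2) = 0.
  by rewrite seq_symbol_steinberg //= addKx.
have ac0 : $ (s1 ++ a :: c :: s2) = 0.
  have := @seq_symbol1 F 2 n s1 (c :: s2) (units_mul a (units_inv a)).
  rewrite (@seq_symbolM F 2 n s1 (c :: s2) a (units_inv a)) // dc0 addr0.
  by apply; rewrite /= mulfV ?(valP a).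
by move: ab0; rewrite -cat_rcons (seq_symbolM _ _ _ _ bE) !cat_rcons ac0 addr0.
Qed.

(** Expanding [{ab, ab} = 0] leaves [{a, b} + {b, a} = 0], and signs disappear modulo 2. *)
Lemma seq_symbol_swap s1 s2 a b :
  $ (s1 ++ a :: b :: s2) = $ (s1 ++ b :: a :: s2).
Proof.
have mulE : val (units_mul a b) = val a * val b by [].
have := seq_symbol_xx s1 s2 (units_mul a b).
rewrite (seq_symbolM _ _ _ _ mulE) -!(cat_rcons _ s1).
rewrite !(seq_symbolM _ _ _ _ mulE) !cat_rcons !seq_symbol_xx.
rewrite add0r addr0 => /eqP; rewrite addr_eq0 => /eqP ->.
by apply/eqP; rewrite eq_sym -addr_eq0 milnorK_mod2_addxx.
Qed.

Lemma seq_symbol_move s r u a : $ (s ++ r ++ a :: u) = $ (s ++ a :: r ++ u).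
Proof.
elim: r s => [//|x r IHr] s.
by rewrite /= -cat_rcons IHr cat_rcons seq_symbol_swap.
Qed.

Lemma seq_symbol_catC s t : $ (s ++ t) = $ (t ++ s).
Proof.
suff catCr u : $ (u ++ s ++ t) = $ (u ++ t ++ s) by exact: (catCr [::]).
elim: s u => [|x s IHs] u; first by rewrite cats0.
by rewrite seq_symbol_move -!cat_rcons IHs.
Qed.

(** Swaps bring the two copies of [a] side by side. *)
Lemma seq_symbol_common s t a : a \in s -> a \in t -> $ (s ++ t) = 0.
Proof.
move=> /splitPr[s1 s2] /splitPr[t1 t2].
rewrite -catA cat_cons (catA s2) -cat_rcons seq_symbol_move cat_rcons.
exact: seq_symbol_xx.
Qed.

End CharTwo.

(** * Descent of the divided square to [K_n / 2] *)

Section DividedPower.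
Variables (F : fieldType) (n : nat).
Hypothesis charF2 : 2%N \in [pchar F].
Hypothesis n_gt1 : (1 < n)%N.
Local Notation T := (n.-tuple (units F)).
Implicit Types (s t : T) (x y z : {freeg T}).

Definition cat_symbol s t := seq_symbol 2 (n + n) (s ++ t).

Lemma cat_symbol_sym s t : cat_symbol s t = cat_symbol t s.
Proof. exact: seq_symbol_catC. Qed.

Lemma cat_symbol_alt s : cat_symbol s s = 0.
Proof.
case: s => [[|a s] sz]; first by exfalso; move: n_gt1; rewrite -(eqP sz).
by apply: (@seq_symbol_common _ _ charF2 _ _ a); rewrite mem_head.
Qed.

(** Appending a fixed tuple to a relation in degree [n] gives a relation of the same kind in degree
    [n + n]. *)
Lemma bilift_relation_eq0 x y : milnor_relation x -> bilift cat_symbol x y = 0.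
Proof.
case=> [s1 s2 a b c ta tb tc cE ea eb ec | s1 s2 a b t ab1 te];
  (elim/freeg_zmod_ind: y => [|u|y1 y2 IH1 IH2];
    [exact: bilift0r | | by rewrite biliftBr IH1 IH2 subrr]).
- rewrite biliftBl biliftDl !biliftU /cat_symbol ea eb ec -!catA !cat_cons.
  by rewrite (seq_symbolM _ _ _ _ cE) subrr.
- by rewrite biliftU /cat_symbol te -catA !cat_cons seq_symbol_steinberg.
Qed.

Lemma bilift_generated_eq0 x y :
  generated (@milnor_relation F n) x -> bilift cat_symbol x y = 0.
Proof.
elim=> [{}x Rx||x1 x2 _ IH1 _ IH2]; first exact: bilift_relation_eq0.
  exact: bilift0l.
by rewrite biliftBl IH1 IH2 subrr.
Qed.

(** [gamma] need not be additive, but its defect [bilift cat_symbol] vanishes on the subgroup of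
    relations, so checking single relations suffices. *)
Lemma divided_square_generated_eq0
    (gamma : {freeg T} -> milnorK_mod F 2 (n + n)) :
  (forall t, gamma << t >> = 0) ->
  (forall x y, gamma (x + y) = gamma x + gamma y + bilift cat_symbol x y) ->
  forall x, generated (@milnor_relation F n) x -> gamma x = 0.
Proof.
move=> gU gD.
have g0 : gamma 0 = 0.
  have := gD 0 0; rewrite bilift0l !addr0 => /esym/eqP.
  by rewrite -subr_eq0 addrK => /eqP.
have gB x y : gamma y = 0 -> bilift cat_symbol (x - y) y = 0 ->
  gamma (x - y) = gamma x.
  by move=> gy By; have := gD (x - y) y; rewrite subrK gy By !addr0.
move=> x; elim=> [{}x Rx||x1 x2 gen1 IH1 gen2 IH2].
- have Bx y := bilift_relation_eq0 y Rx.
  case: Rx Bx => [s1 s2 a b c ta tb tc cE ea eb ec | s1 s2 a b t ab1 te] // Bx.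
  (* The head of [s1] is shared; if [s1] is empty, [n > 1] makes [s2] nonempty and its head is
     shared. *)
  have common : exists d, d \in tval ta /\ d \in tval tb.
    have := size_tuple ta; rewrite ea eb.
    case: s1 {ea eb ec} => [|d s1].
      case: s2 => [sz|d s2 _]; first by move: n_gt1; rewrite -sz.
      by exists d; rewrite !inE eqxx !orbT.
    by exists d; rewrite !inE eqxx.
  have [d [da db]] := common.
  have fab : bilift cat_symbol << ta >> << tb >> = 0.
    by rewrite biliftU; apply: seq_symbol_common da db.
  have gab : gamma (<< ta >> + << tb >>) = 0 by rewrite gD !gU fab !addr0.
  by rewrite gB ?gU.
- exact: g0.
- by rewrite gB // bilift_generated_eq0 //; apply: generated_sub.
Qed.

Lemma symbol_sum_cat_wd (s t s' t' : T) :
  symbol_mod 2 s + symbol_mod 2 t = symbol_mod 2 s' + symbol_mod 2 t'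
    :> milnorK_mod F 2 n ->
  cat_symbol s t = cat_symbol s' t'.
Proof.
have V2 := @milnorK_mod2_addxx F (n + n).
have [gamma [gU gD]] := divided_square_exists cat_symbol_sym cat_symbol_alt.
have fE u v : cat_symbol u v = gamma (<< u >> + << v >>).
  by rewrite gD !gU !add0r biliftU.
rewrite !fE /symbol_mod /symbol -!raddfD => /eqP.
(* The two quotients are unwound in turn: the difference is [y *+ 2] in [K_n], then [y] is lifted to
   the free group. *)
rewrite -idealrBE => /asboolP[y]; rewrite -[y]reprK -!raddfB -raddfMn => /eqP.
rewrite -idealrBE => /asboolP.
set x := << s >> + _; set x' := << s' >> + _; set z := repr y => gen.
(* With [w = x - x' - z *+ 2] a combination of relations, [gamma w] and all pairings with [w]
   vanish; [gamma (z + z)] is twice [gamma z] plus the pairing of [z] with itself, hence 0. *)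
have -> : x = x - x' - z *+ 2 + (x' + (z + z)).
  by rewrite mulr2n [x' + _]addrC addrA subrK subrK.
rewrite gD (divided_square_generated_eq0 gU gD gen) bilift_generated_eq0 //.
rewrite add0r addr0.
rewrite gD (gD z z) V2 (bilift_alt V2 cat_symbol_sym cat_symbol_alt).
by rewrite biliftDr !V2 !addr0.
Qed.

End DividedPower.

Theorem corollary3p4 (F : fieldType) (charF2 : 2%N \in [pchar F])
    (a b c d alpha beta gamma delta : units F) :
  symbol_mod 2 [tuple a; b] + symbol_mod 2 [tuple c; d] =
    symbol_mod 2 [tuple alpha; beta] + symbol_mod 2 [tuple gamma; delta]
    :> milnorK_mod F 2 2 ->
  symbol_mod 2 [tuple a; b; c; d] =
    symbol_mod 2 [tuple alpha; beta; gamma; delta]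
    :> milnorK_mod F 2 4.
Proof.
(* Both [2 + 2] and the concatenated pairs reduce by computation, so no transport between degrees
   occurs. *)
by move/(@symbol_sum_cat_wd F 2 charF2 isT); rewrite /cat_symbol -!seq_symbolE.
Qed.
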